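(* Any distributed delay can be approximated by a lumped system in the graph topology; that is, for all reals $0\le\vartheta_1<\vartheta_2$, every $f\in\mathscr{K}([\vartheta_1,\vartheta_2])$ and every $\varepsilon>0$, there exists $g\in\mathscr{Q}$ such that $\|f-g\|_{\mathscr{A}}\leq\varepsilon$.
   Context: $\mathscr{A}$ is the set of distributions supported on $[0,\infty)$ of the form $f=f_a+\sum_{n\ge 0}f_n\delta(t-t_n)$, with $f_a\in\mathscr{L}_1(\mathbb{R}_+)$ complex valued, $f_n\in\mathbb{C}$, $0=t_0<t_1<t_2<\dots$, $\sum_n|f_n|<\infty$, and $\delta(t-t_n)$ the Dirac distribution at $t_n$. It is a commutative Banach algebra under convolution, with unit $\delta$ and norm $\|f\|_{\mathscr{A}}=\|f_a\|_{\mathscr{L}_1}+\sum_{n}|f_n|$. For a closed interval $I\subset[0,\infty)$ (bounded, or $[0,\infty)$), $\mathscr{K}(I)$ is the set of functions that vanish outside $I$ and equal on $I$ a finite sum $\sum_{i,j\geq 0}c_{ij}t^je^{\lambda_i t}$ with $c_{ij},\lambda_i\in\mathbb{C}$. $\mathscr{K}_s(I)$ is the subset of those for which all $\mathrm{Re}\,\lambda_i<0$. A distributed delay is a causal convolution operator $y=f\ast u$ with kernel $f\in\mathscr{K}([\vartheta_1,\vartheta_2])$ for some real numbers $0\le\vartheta_1<\vartheta_2$; it is identified with its kernel. The class of lumped systems is the class of convolution operators whose kernels lie in $\mathscr{Q}=\{g\in\mathscr{A}: g=g_0\delta+g_a,\ g_0\in\mathbb{C},\ g_a\in\mathscr{K}_s([0,\infty))\}$.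 For elements of $\mathscr{A}$ the graph topology coincides with the topology of the norm $\|\cdot\|_{\mathscr{A}}$; $p\in\mathscr{A}$ can be approximated by a class of elements of $\mathscr{A}$ in the graph topology if for every $\varepsilon>0$ some $p_\varepsilon$ in the class satisfies $\|p-p_\varepsilon\|_{\mathscr{A}}\le\varepsilon$. *)

(* Defs.v *)
From mathcomp Require Export all_boot all_order all_algebra.
From mathcomp Require Export complex.
From mathcomp Require Export all_classical all_reals all_analysis.

Set Implicit Arguments.
Unset Strict Implicit.
Unset Printing Implicit Defensive.

Export Order.TTheory GRing.Theory Num.Theory.
Export numFieldNormedType.Exports.
Export ComplexField.Normc.

#[global] Open Scope classical_set_scope.
#[global] Open Scope complex_scope.
#[global] Open Scope ring_scope.

Definition expc (R : realType) (z : R[i]) : R[i] :=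
  (expR (complex.Re z))%:C * (cos (complex.Im z) +i* sin (complex.Im z)).

(* [f : adist R] stands for the distribution
     f.1 + \sum_(x : R) f.2 x * delta(t - x),
   where [f.1] is a representative of the absolutely continuous part and [f.2]
   gives the masses of the Dirac distributions.  The masses, and [f.1] up to
   null sets, are determined by the distribution, and [normA] depends on nothing
   else.  Addition, opposite and scaling are those of the product of the two
   function spaces, hence those of distributions. *)
Definition adist (R : realType) : Type := ((R -> R[i]^o) * (R -> R[i]^o))%type.

Definition dens (R : realType) (f : R -> R[i]) : adist R := (f, fun=> 0).

Definition dirac0 (R : realType) : adist R := (fun=> 0, fun x => (x == 0)%:R).

Definition normL1 (R : realType) (f : R -> R[i]) : \bar R :=
  (\int[@lebesgue_measure R]_(t in `[0%R, +oo[) (normc (f t))%:E)%E.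

Definition normA (R : realType) (f : adist R) : \bar R :=
  (normL1 f.1 + \esum_(x in [set: R]) (normc (f.2 x))%:E)%E.

Definition isL1 (R : realType) (f : R -> R[i]) : Prop :=
  [/\ forall t, t < 0 -> f t = 0,
      measurable_fun [set: R] (fun t => complex.Re (f t)),
      measurable_fun [set: R] (fun t => complex.Im (f t)) &
      (normL1 f < +oo)%E].

(* The mass [f_n] of the Dirac distribution at [t_ n] is [f.2 (t_ n)]. *)
Definition calA (R : realType) : set (adist R) := [set f |
  isL1 f.1 /\
  exists t_ : nat -> R,
    [/\ t_ 0%N = 0, forall n, t_ n < t_ n.+1,
        forall x, f.2 x != 0 -> exists n, x = t_ n &
        (\sum_(0 <= n <oo) (normc (f.2 (t_ n)))%:E < +oo)%E]].

Definition exp_poly (R : realType) (m n : nat) (c : 'I_m -> 'I_n -> R[i])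
    (lambda : 'I_m -> R[i]) (t : R) : R[i] :=
  \sum_(i < m) \sum_(j < n) c i j * t%:C ^+ j * expc (lambda i * t%:C).

Definition calK (R : realType) (I : set R) : set (R -> R[i]) := [set f |
  (forall t, ~ I t -> f t = 0) /\
  exists m n (c : 'I_m -> 'I_n -> R[i]) (lambda : 'I_m -> R[i]),
    forall t, I t -> f t = exp_poly c lambda t].

Definition calKs (R : realType) (I : set R) : set (R -> R[i]) := [set f |
  (forall t, ~ I t -> f t = 0) /\
  exists m n (c : 'I_m -> 'I_n -> R[i]) (lambda : 'I_m -> R[i]),
    (forall i, complex.Re (lambda i) < 0) /\
    forall t, I t -> f t = exp_poly c lambda t].

Definition calQ (R : realType) : set (adist R) := [set g |
  calA g /\
  exists (g0 : R[i]) (ga : R -> R[i]),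
    calKs `[0, +oo[ ga /\ g = g0 *: dirac0 R + dens ga].

(* Main.v *)
(* In the variable [x = e^{-t}] a function [h] on [0, +oo[ reads [e^{-t} k(e^{-t})],
   and [e^{-t} p(e^{-t})] with [p] a polynomial is a combination of the
   exponentials [e^{-(i+1)t}].  For [h] bounded with bounded support, the Bernstein
   polynomials of [k] are uniformly bounded and converge to [k] at its continuity
   points, so dominated convergence against [e^{-t}] gives convergence in L1.  For a
   distributed delay, [k] is continuous except at the two points coming from
   the ends of the interval. *)
Require Import Defs.
From mathcomp Require Import measurable_realfun ring lra.

Set Implicit Arguments.
Unset Strict Implicit.
Unset Printing Implicit Defensive.

(** * Bernstein polynomials: positivity, moments, pointwise convergence *)

Section Bernstein.
Context {R : realType}.

(* Pascal's rule, unfolded from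
   [\sum_(i <= n) 'C(n, i) F i 'X^i (1 - 'X)^(n - i)]. *)
Fixpoint bernstein (n : nat) (F : nat -> R) : {poly R} :=
  if n is m.+1 then 'X * bernstein m (F \o S) + (1 - 'X) * bernstein m F
  else (F 0)%:P.

Implicit Types (x c M : R) (F G : nat -> R) (k : R -> R).

Lemma horner_bernsteinS n F x : (bernstein n.+1 F).[x] =
  x * (bernstein n (F \o S)).[x] + (1 - x) * (bernstein n F).[x].
Proof. by rewrite /= !(hornerD, hornerM, hornerN, hornerC, hornerX). Qed.

(** Positivity of the Bernstein operator: for [x] in [[0, 1]] each step of the recursion is a convex
    combination with weights [x] and [1 - x]. *)
Lemma ler_norm_bernstein n F G x : 0 <= x <= 1 ->
  (forall i, (i <= n)%N -> `|F i| <= G i) ->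
  `|(bernstein n F).[x]| <= (bernstein n G).[x].
Proof.
move=> /andP[x0 x1]; elim: n F G => [|n IH] F G FG.
  by rewrite !hornerC FG.
have y0 : 0 <= 1 - x by rewrite subr_ge0.
rewrite !horner_bernsteinS (le_trans (ler_normD _ _))// !normrM.
rewrite (ger0_norm x0) (ger0_norm y0) lerD// ler_wpM2l// IH// => i ni.
- exact: FG.
- exact/FG/leqW.
Qed.

Lemma bernsteinBcst n F c x :
  (bernstein n (fun i => F i - c)).[x] = (bernstein n F).[x] - c.
Proof.
elim: n F => [|n IH] F; first by rewrite !hornerC.
rewrite !horner_bernsteinS IH (IH (F \o S)); ring.
Qed.

Lemma bernstein_cst n c x : (bernstein n (fun=> c)).[x] = c.
Proof.
by elim: n => [|n IH]; rewrite ?hornerC// horner_bernsteinS !IH; ring.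
Qed.

(** Second moment of the binomial law, of mean [n x] and variance [n x (1 - x)]. The induction runs
    over all centres [c], because the shift [F \o S] turns [c] into [c - 1]. *)
Lemma bernstein_sqr n a b c x :
  (bernstein n (fun i => a + b * (i%:R - c) ^+ 2)).[x] =
  a + b * ((n%:R * x - c) ^+ 2 + n%:R * x * (1 - x)).
Proof.
elim: n c => [|n IH] c; first by rewrite !hornerC; ring.
rewrite horner_bernsteinS IH.
have -> : (fun i => a + b * (i%:R - c) ^+ 2) \o S =
          (fun i => a + b * (i%:R - (c - 1)) ^+ 2).
  by apply/funext => i /=; rewrite -natr1; ring.
by rewrite IH -natr1; ring.
Qed.

(* Chebyshev: off the [d]-neighbourhood of [x] the increments of [k] are
   dominated by [2 M (y - x)^2 / d^2]. *)
Lemma bernstein_cvg k M x : 0 <= x <= 1 ->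
    (forall y, 0 <= y <= 1 -> `|k y| <= M) -> {for x, continuous k} ->
  (bernstein n (fun i => k (i%:R / n%:R))).[x] @[n --> \oo] --> k x.
Proof.
move=> x01 kM kx.
have M0 : 0 <= M by rewrite (le_trans _ (kM _ x01)).
apply/cvgrPdist_le => e e0.
have /cvgrPdist_le/(_ (e / 2)) := kx.
rewrite divr_gt0// => /(_ isT)[d /= d0 kd].
near=> n.
have n0 : 0 < n%:R :> R by near: n; exact: nbhs_infty_gtr.
rewrite distrC -bernsteinBcst.
(* With this scaling, [b (i - n x)^2 = 2 M ((i / n - x) / d)^2], which is at least [2 M] once the
   node [i / n] is at distance [d] or more from [x]. *)
pose b := 2 * M / (d * n%:R) ^+ 2.
have b0 : 0 <= b.
  by rewrite divr_ge0 ?exprn_ge0 ?mulr_ge0 ?(ltW d0) ?(ltW n0).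
apply: (@le_trans _ _
  (bernstein n (fun i => e / 2 + b * (i%:R - n%:R * x) ^+ 2)).[x]).
  apply: ler_norm_bernstein => // i ilen.
  have i01 : 0 <= (i%:R / n%:R : R) <= 1.
    by rewrite divr_ge0 ?ler0n//= ler_pdivrMr// mul1r ler_nat.
  have [xid|] := ltP `|x - i%:R / n%:R| d.
    by rewrite distrC (le_trans (kd _ _))// lerDl mulr_ge0// sqr_ge0.
  move=> dxi.
  apply: (@le_trans _ _ (2 * M)).
    by rewrite (le_trans (ler_normB _ _))// mulr2n mulrDl mul1r lerD// kM.
  apply: (@le_trans _ _ (b * (i%:R - n%:R * x) ^+ 2)); last first.
    by rewrite lerDr divr_ge0// ltW.
  rewrite /b -mulrA ler_peMr ?mulr_ge0// mulrC.
  rewrite ler_pdivlMr ?mul1r ?exprn_gt0 ?mulr_gt0//.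
  have -> : (i%:R - n%:R * x) = - ((x - i%:R / n%:R) * n%:R).
    by field; rewrite gt_eqF.
  rewrite sqrrN !exprMn ler_wpM2r ?sqr_ge0// -[leRHS]real_normK ?num_real//.
  by rewrite ler_pXn2r ?nnegrE ?(ltW d0).
(* The centre [n x] is the mean, so only the variance remains; multiplied by [b] it is of order
   [1 / n]. *)
rewrite bernstein_sqr subrr expr0n/= add0r.
have -> : b * (n%:R * x * (1 - x)) = 2 * M / d ^+ 2 * (x * (1 - x)) / n%:R.
  by rewrite /b; field; rewrite !gt_eqF.
have : 2 * M / d ^+ 2 * (x * (1 - x)) / n%:R <= e / 2.
  rewrite ler_pdivrMr//; apply: (@le_trans _ _ (2 * M / d ^+ 2)).
    rewrite ler_piMr// ?divr_ge0 ?sqr_ge0 ?mulr_ge0//.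
    by move/andP: x01 => [? ?]; nra.
  rewrite -ler_pdivrMl ?divr_gt0//; apply: ltW.
  by near: n; exact: nbhs_infty_gtr.
by move=> ?; lra.
Unshelve. all: end_near. Qed.

End Bernstein.

(** * Real L1 approximation on the half-line by functions [e^{-t} p(e^{-t})] *)

Section ExpPolynomial.
Context {R : realType}.
Notation mu := (@lebesgue_measure R).

Lemma continuous_expRN : continuous (fun t : R => expR (- t)).
Proof.
move=> t; apply: continuous_comp; first exact: opp_continuous.
exact: continuous_expR.
Qed.

Lemma continuous_horner_expRN (p : {poly R}) :
  continuous (fun t : R => expR (- t) * p.[expR (- t)]).
Proof.
move=> t; apply: cvgM; first exact: continuous_expRN.
apply: (@continuous_comp _ _ _ (fun t => expR (- t)) (horner p)).
  exact: continuous_expRN.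
exact: continuous_horner.
Qed.

Lemma continuous_patch_itv (phi : R -> R) (a b t : R) :
  continuous phi -> t != a -> t != b -> {for t, continuous (phi \_ `[a, b])}.
Proof.
move=> cphi ta tb.
have [tab|] := boolP (t \in `]a, b[).
  apply: (@cvg_trans _ (phi x @[x --> t])).
    apply: near_eq_cvg; near=> x.
    rewrite patchE mem_set//=; apply: subset_itv_oo_cc.
    by near: x; exact: near_in_itvoo.
  rewrite patchE mem_set//=; last exact: subset_itv_oo_cc.
  exact: cphi.
rewrite in_itv/= negb_and -!leNgt !le_eqVlt (negPf ta) eq_sym (negPf tb)/=.
move=> tab.
have tN : t \notin `[a, b]%classic.
  by apply/negP; rewrite inE/= in_itv/=; case/orP: tab => ?; lra.
rewrite /prop_for /continuous_at patchE (negPf tN).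
apply: cvg_near_cst.
case/orP: tab => tab; near=> x; rewrite patchE memNset//= in_itv/=.
  have : x < a by near: x; exact: lt_nbhsl.
  by move=> *; apply/negP; lra.
have : b < x by near: x; exact: lt_nbhsr.
by move=> *; apply/negP; lra.
Unshelve. all: end_near. Qed.

Lemma measurable_patch_itv (phi : R -> R) (i : interval R) :
  continuous phi -> measurable_fun [set: R] (phi \_ [set` i]).
Proof.
move=> cphi; apply/(measurable_restrictT _ (measurable_itv i)).
by apply: measurable_funTS; exact: continuous_measurable_fun.
Qed.

(** In the variable [x = e^{-t}] the factor [expR t] is [1 / x], so [M] will bound the function
    whose Bernstein polynomials are taken. *)
Lemma bounded_patch_itv_expR (phi : R -> R) (a b : R) :
  a <= b -> continuous phi ->
  exists2 M : R, 0 <= M & forall t, `|(phi \_ `[a, b]) t| * expR t <= M.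
Proof.
move=> ab cphi; pose psi t := `|phi t| * expR t.
have cpsi : continuous psi.
  move=> t; apply: cvgM; last exact: continuous_expR.
  apply: (@continuous_comp _ _ _ phi Num.norm); first exact: cphi.
  exact: norm_continuous.
have [c _ psic] := EVT_max ab (continuous_subspaceT cpsi).
have psi0 t : 0 <= psi t by rewrite mulr_ge0 ?normr_ge0 ?expR_ge0.
exists (psi c) => // t; rewrite patchE; case: ifPn => [|_].
  by rewrite inE/= => tab; exact: psic.
by rewrite normr0 mul0r.
Qed.

Lemma L1_approx_expRN (phi : R -> R) (a b eps : R) :
  a <= b -> continuous phi -> 0 < eps ->
  exists p : {poly R}, (\int[mu]_(t in `[0%R, +oo[)
    `|(phi \_ `[a, b]) t - expR (- t) * p.[expR (- t)]|%:E <= eps%:E)%E.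
Proof.
move=> ab cphi eps0; have [M M0 hM] := bounded_patch_itv_expR ab cphi.
set h := phi \_ _ in hM *.
have mh : measurable_fun [set: R] h by exact: measurable_patch_itv.
(* Chosen so that [h t = e^{-t} k(e^{-t})]. The convention [0^-1 = 0] gives [k 0 = 0], which keeps
   the bound [M] valid at the endpoint [0]. *)
pose k x := h (- ln x) / x.
have kM y : 0 <= y <= 1 -> `|k y| <= M.
  move=> /andP[]; rewrite le_eqVlt => /predU1P[<-|y0] _.
    by rewrite /k invr0 mulr0 normr0.
  rewrite /k normrM -[X in `|X^-1|]lnK ?posrE//.
  by rewrite -expRN (ger0_norm (expR_ge0 _)); exact: hM.
have kE t : k (expR (- t)) = h t * expR t by rewrite /k expRK opprK expRN invrK.
have kx t : t != a -> t != b -> {for expR (- t), continuous k}.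
  move=> ta tb; apply: cvgM; last first.
    by apply: inv_continuous; rewrite gt_eqF ?expR_gt0.
  apply: (@continuous_comp _ _ _ (fun x => - ln x) h).
    by apply: cvgN; exact/continuous_ln/expR_gt0.
  by rewrite /= expRK opprK; exact: continuous_patch_itv.
pose B n := bernstein n (fun i => k (i%:R / n%:R)).
pose f_ n t := (h t - expR (- t) * (B n).[expR (- t)])%:E.
have mf n : measurable_fun (`[0, +oo[%classic : set R) (f_ n).
  apply/measurable_EFinP/measurable_funTS/measurable_funB => //.
  by apply: continuous_measurable_fun; exact: continuous_horner_expRN.
have e01 t : 0 <= t -> 0 <= expR (- t) <= 1.
  by move=> t0; rewrite expR_ge0/= -expR0 ler_expR oppr_le0.
have f0 : {ae mu, forall t, (`[0, +oo[%classic : set R) t ->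
    f_ n t @[n --> \oo] --> (cst 0%E) t}.
  (* Convergence can fail only at the jumps [a] and [b], which form a null set. *)
  have : mu.-negligible [set a; b].
    by apply: negligibleU; apply/negligibleP => //; exact: lebesgue_measure_set1.
  apply: negligibleS => t /= /not_implyP[t0 ft].
  apply: contrapT => /not_orP[/eqP ta /eqP tb]; apply: ft.
  rewrite in_itv/= andbT in t0.
  apply/cvg_EFin; first exact: nearW.
  have hk : h t - expR (- t) * k (expR (- t)) = 0.
    by rewrite kE mulrCA -expRD addNr expR0 mulr1 subrr.
  rewrite [X in _ --> X](_ : _ = h t - expR (- t) * k (expR (- t)))//.
  apply: cvgB; first exact: cvg_cst.
  apply: cvgM; first exact: cvg_cst.
  by apply: (@bernstein_cvg _ _ M); [exact: e01|exact: kM|exact: kx].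
(* Both [h t] and [e^{-t} B_n(e^{-t})] are at most [M e^{-t}] in absolute value; [e^{-t}] is written
   as the exponential density of rate 1, known to be integrable. *)
pose g t := ((2 * M) * exponential_pdf 1 t)%:E.
have ig : mu.-integrable `[0%R, +oo[ g.
  apply: (@integrableZl _ _ _ mu _ _ (2 * M) (EFin \o exponential_pdf 1)) => //.
  exact: integrableS (integrable_exponential_pdf ltr01).
have fg : {ae mu, forall t, forall n,
    (`[0, +oo[%classic : set R) t -> (`|f_ n t| <= g t)%E}.
  apply: aeW => t n /=; rewrite in_itv/= andbT => t0.
  rewrite lee_fin exponential_pdfE// mul1r mulN1r.
  rewrite (le_trans (ler_normB _ _))// mulr2n !mulrDl mul1r lerD//.
    rewrite -[leLHS]mulr1 -(expR0 R) -(addrN t) expRD mulrA.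
    by rewrite ler_wpM2r ?expR_ge0.
  rewrite normrM mulrC (ger0_norm (expR_ge0 _)) ler_wpM2r ?expR_ge0//.
  rewrite -[leRHS](bernstein_cst n M (expR (- t))).
  apply: ler_norm_bernstein; first exact: e01.
  move=> i ilen; apply: kM.
  (* For [n = 0] the node [i / 0] is [0], still in [[0, 1]]. *)
  case: n ilen => [|n] ilen; first by rewrite invr0 mulr0 lexx ler01.
  by rewrite divr_ge0 ?ler0n//= ler_pdivrMr ?ltr0n// mul1r ler_nat.
have [_ + _] := @dominated_convergence _ _ R mu _ (measurable_itv _) f_
  (cst 0%E) g mf (measurable_cst _) f0 ig fg.
move=> /fine_cvgP[finn /cvgrPdist_le/(_ _ eps0) le].
near \oo => n; exists (B n).
have : (\int[mu]_(x in `[0%R, +oo[) `|f_ n x - 0| <= eps%:E)%E.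
  rewrite -[leLHS]fineK; last by near: n.
  rewrite lee_fin.
  near: n; apply: filterS le => m.
  by rewrite sub0r normrN; exact: le_trans (ler_norm _).
under eq_integral do rewrite sube0.
done.
Unshelve. all: end_near. Qed.

(** Dominated by [e^{-t}] times the maximum of [|p|] on [[0, 1]]. This puts the approximating kernel
    in [calA]. *)
Lemma integral_horner_expRN_lty (p : {poly R}) :
  (\int[mu]_(t in `[0%R, +oo[) `|expR (- t) * p.[expR (- t)]|%:E < +oo)%E.
Proof.
have cnp : continuous (fun x : R => `|p.[x]|).
  move=> x; apply: (@continuous_comp _ _ _ (horner p) Num.norm).
    exact: continuous_horner.
  exact: norm_continuous.
have [c _ pc] := EVT_max ler01 (continuous_subspaceT cnp).
have ig : mu.-integrable `[0%R, +oo[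
    (fun t => (`|p.[c]| * exponential_pdf 1 t)%:E).
  apply: (@integrableZl _ _ _ mu _ _ `|p.[c]| (EFin \o exponential_pdf 1)) => //.
  exact: integrableS (integrable_exponential_pdf ltr01).
have : mu.-integrable `[0%R, +oo[ (fun t => (expR (- t) * p.[expR (- t)])%:E).
  apply: (le_integrable _ _ _ ig) => //.
    apply/measurable_EFinP/measurable_funTS.
    by apply: continuous_measurable_fun; exact: continuous_horner_expRN.
  move=> t /=; rewrite in_itv/= andbT => t0.
  rewrite lee_fin exponential_pdfE// mul1r mulN1r mulrC.
  rewrite 2!normrM normr_id ler_wpM2r//.
  by apply: pc; rewrite in_itv/= expR_ge0/= -expR0 ler_expR oppr_le0.
by move=> /integrableP[].
Qed.

End ExpPolynomial.

(** * Complex kernels through their real and imaginary parts *)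

Section ComplexValued.
Context {R : realType}.
Notation mu := (@lebesgue_measure R).
Notation Re := complex.Re.
Notation Im := complex.Im.
Implicit Types F G : R -> R[i].

(** Stated componentwise because the real L1 approximation is applied to each component. *)
Definition continuousC F :=
  continuous (fun t => Re (F t)) /\ continuous (fun t => Im (F t)).

Lemma continuousC_cst z : continuousC (fun=> z).
Proof. by split=> t; exact: cvg_cst. Qed.

Lemma continuousCD F G :
  continuousC F -> continuousC G -> continuousC (fun t => F t + G t).
Proof.
move=> [Fr Fi] [Gr Gi]; split=> t.
  rewrite (_ : (fun t => _) = (fun t => Re (F t) + Re (G t))).
    by apply: cvgD; [exact: Fr|exact: Gr].
  by apply/funext => u; case: (F u); case: (G u).
rewrite (_ : (fun t => _) = (fun t => Im (F t) + Im (G t))).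
  by apply: cvgD; [exact: Fi|exact: Gi].
by apply/funext => u; case: (F u); case: (G u).
Qed.

Lemma continuousC_sum (I : Type) (r : seq I) (F : I -> R -> R[i]) :
  (forall i, continuousC (F i)) -> continuousC (fun t => \sum_(i <- r) F i t).
Proof.
move=> cF; elim: r => [|i r IH].
  by under eq_fun do rewrite big_nil; exact: continuousC_cst.
by under eq_fun do rewrite big_cons; exact: continuousCD.
Qed.

Lemma continuousCM F G :
  continuousC F -> continuousC G -> continuousC (fun t => F t * G t).
Proof.
move=> [Fr Fi] [Gr Gi]; split=> t.
  rewrite (_ : (fun t => _) =
    (fun t => Re (F t) * Re (G t) - Im (F t) * Im (G t))).
    by apply: cvgB; apply: cvgM; [exact: Fr|exact: Gr|exact: Fi|exact: Gi].
  by apply/funext => u; case: (F u); case: (G u).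
rewrite (_ : (fun t => _) =
  (fun t => Re (F t) * Im (G t) + Im (F t) * Re (G t))).
  by apply: cvgD; apply: cvgM; [exact: Fr|exact: Gi|exact: Fi|exact: Gr].
by apply/funext => u; case: (F u); case: (G u).
Qed.

Lemma continuousCX F n : continuousC F -> continuousC (fun t => F t ^+ n).
Proof.
move=> cF; elim: n => [|n IH]; first exact: continuousC_cst.
by under eq_fun do rewrite exprS; exact: continuousCM.
Qed.

Lemma continuousC_ofReal : continuousC (fun t => t%:C).
Proof. by split=> t; [exact: cvg_id|exact: cvg_cst]. Qed.

Lemma continuousC_expc F : continuousC F -> continuousC (fun t => expc (F t)).
Proof.
move=> [Fr Fi]; apply: continuousCM; split=> t /=.
- apply: (@continuous_comp R R R (fun t => Re (F t)) expR); first exact: Fr.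
  exact: continuous_expR.
- exact: cvg_cst.
- apply: (@continuous_comp R R R (fun t => Im (F t)) cos); first exact: Fi.
  exact: continuous_cos.
- apply: (@continuous_comp R R R (fun t => Im (F t)) sin); first exact: Fi.
  exact: continuous_sin.
Qed.

Lemma continuousC_exp_poly m n (c : 'I_m -> 'I_n -> R[i])
  (lambda : 'I_m -> R[i]) : continuousC (exp_poly c lambda).
Proof.
apply: continuousC_sum => i; apply: continuousC_sum => j.
apply: continuousCM.
  apply: continuousCM; first exact: continuousC_cst.
  exact/continuousCX/continuousC_ofReal.
apply: continuousC_expc; apply: continuousCM; first exact: continuousC_cst.
exact: continuousC_ofReal.
Qed.

Lemma normcE (z : R[i]) : normc z = Num.sqrt (Re z ^+ 2 + Im z ^+ 2).
Proof. by case: z. Qed.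

Lemma normc_le_ReIm (z : R[i]) : normc z <= `|Re z| + `|Im z|.
Proof.
rewrite normcE -[leRHS]ger0_norm ?addr_ge0// -sqrtr_sqr ler_wsqrtr//.
by rewrite sqrrD !real_normK ?num_real// lerD2r lerDl mulrn_wge0// mulr_ge0.
Qed.

Lemma normL1_le_ReIm F :
  measurable_fun [set: R] (fun t => Re (F t)) ->
  measurable_fun [set: R] (fun t => Im (F t)) ->
  (normL1 F <= \int[mu]_(t in `[0%R, +oo[) `|Re (F t)|%:E
             + \int[mu]_(t in `[0%R, +oo[) `|Im (F t)|%:E)%E.
Proof.
move=> mr mi.
have mnr : measurable_fun (`[0, +oo[ : set R) (fun t => `|Re (F t)|%:E).
  by apply/measurable_EFinP/measurable_funTS; exact: measurableT_comp.
have mni : measurable_fun (`[0, +oo[ : set R) (fun t => `|Im (F t)|%:E).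
  by apply/measurable_EFinP/measurable_funTS; exact: measurableT_comp.
rewrite -ge0_integralD//.
apply: ge0_le_integral => //.
- by move=> t _; rewrite lee_fin normcE sqrtr_ge0.
- apply/measurable_EFinP/measurable_funTS; under eq_fun do rewrite normcE.
  apply: (@measurableT_comp _ _ _ _ _ _ (@Num.sqrt R)).
    by apply: continuous_measurable_fun; exact: sqrt_continuous.
  by apply: measurable_funD; exact: measurable_funX.
- exact: emeasurable_funD.
- by move=> t _; rewrite -EFinD lee_fin normc_le_ReIm.
Qed.

Lemma expc_real (x : R) : expc x%:C = (expR x)%:C.
Proof. by rewrite /expc /= cos0 sin0 mulr1. Qed.

Lemma sum_complex (I : Type) (r : seq I) (a b : I -> R) :
  \sum_(i <- r) (a i +i* b i) = (\sum_(i <- r) a i) +i* (\sum_(i <- r) b i).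
Proof. by elim: r => [|i r IH]; rewrite ?big_nil// !big_cons IH. Qed.

(** This is [e^{-t} (p + i q)(e^{-t})], kept as a pair since [p] and [q] come from two separate real
    approximations. *)
Definition horner_exp (p q : {poly R}) (t : R) : R[i] :=
  (expR (- t) * p.[expR (- t)]) +i* (expR (- t) * q.[expR (- t)]).

(** The factor [e^{-t}] shifts the exponent of the [i]-th monomial to [-(i + 1)], strictly negative
    even for the constant term. Only the power [t^0] occurs, and [n] pads both polynomials to a
    common length. *)
Lemma horner_exp_exp_poly (p q : {poly R}) (n := maxn (size p) (size q)) t :
  horner_exp p q t =
  exp_poly (fun (i : 'I_n) (_ : 'I_1) => p`_i +i* q`_i)
    (fun i => (- i.+1%:R)%:C) t.
Proof.
rewrite /horner_exp /exp_poly !(@horner_coef_wide _ n) ?leq_maxl ?leq_maxr//.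
rewrite !mulr_sumr -sum_complex; apply: eq_bigr => i _.
rewrite big_ord1 expr0 mulr1 -rmorphM expc_real.
rewrite mulNr -mulrN expRM_natl exprS.
apply/eqP; rewrite eq_complex/= !mulr0 !subr0 !add0r.
by apply/andP; split; apply/eqP; ring.
Qed.

End ComplexValued.

(** * Assembling the lumped kernel, each component having error at most [eps / 2] *)

Theorem corollary1 (R : realType) (theta1 theta2 : R) (f : R -> R[i])
  (theta1_ge0 : 0 <= theta1) (theta12 : theta1 < theta2)
  (fK : calK `[theta1, theta2] f) (eps : R) (eps_gt0 : 0 < eps) :
  exists2 g : adist R, calQ g & (normA (dens f - g)%R <= eps%:E)%E.
Proof.
case: fK => f0 [m [n [c [lambda fE]]]].
have [cr ci] := continuousC_exp_poly c lambda.
have eps2 : 0 < eps / 2 by rewrite divr_gt0.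
have [p hp] := L1_approx_expRN (ltW theta12) cr eps2.
have [q hq] := L1_approx_expRN (ltW theta12) ci eps2.
set fr := _ \_ _ in hp; set fi := _ \_ _ in hq.
(* Valid on the whole line: off the interval [f] and both restrictions vanish. *)
have fri t : f t = fr t +i* fi t.
  rewrite /fr /fi !patchE; case: ifPn => [/set_mem tI|/negP tI].
    by rewrite fE//; case: (exp_poly _ _ _).
  by rewrite f0//; move: tI; rewrite inE.
have mfr : measurable_fun [set: R] fr by exact: measurable_patch_itv.
have mfi : measurable_fun [set: R] fi by exact: measurable_patch_itv.
pose ga t : R[i] :=
  if t \in (`[0, +oo[%classic : set R) then horner_exp p q t else 0.
have mexp (s : {poly R}) : measurable_fun [set: R]
    ((fun t => expR (- t) * s.[expR (- t)]) \_ `[0, +oo[).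
  by apply: measurable_patch_itv; exact: continuous_horner_expRN.
have gaR t : complex.Re (ga t) =
    ((fun t => expR (- t) * p.[expR (- t)]) \_ `[0, +oo[) t.
  by rewrite /ga patchE; case: ifPn.
have gaI t : complex.Im (ga t) =
    ((fun t => expR (- t) * q.[expR (- t)]) \_ `[0, +oo[) t.
  by rewrite /ga patchE; case: ifPn.
have mgaR : measurable_fun [set: R] (fun t => complex.Re (ga t)).
  by rewrite (funext gaR); exact: mexp.
have mgaI : measurable_fun [set: R] (fun t => complex.Im (ga t)).
  by rewrite (funext gaI); exact: mexp.
have gaN t : t < 0 -> ga t = 0.
  move=> t0; rewrite /ga memNset//= in_itv/= andbT.
  by apply/negP; rewrite -ltNge.
have gaL1 : isL1 ga.
  split=> //.
  apply: (le_lt_trans (normL1_le_ReIm mgaR mgaI)).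
  apply: lte_add_pinfty.
    under eq_integral => t t0 do rewrite gaR patchE t0.
    exact: integral_horner_expRN_lty.
  under eq_integral => t t0 do rewrite gaI patchE t0.
  exact: integral_horner_expRN_lty.
exists (dens ga).
  split.
    (* All Dirac masses are zero, so any strictly increasing sequence starting at [0] will do. *)
    split=> //; exists (fun n => n%:R); split=> //.
    - by move=> k; rewrite ltr_nat.
    - by move=> x; rewrite /= eqxx.
    - by rewrite eseries0// => k _ _; rewrite normc0.
  exists 0, ga; split; last by rewrite scale0r add0r.
  split.
    by move=> t /= /negP; rewrite in_itv/= andbT -ltNge; exact: gaN.
  exists (maxn (size p) (size q)), 1%N, (fun i _ => p`_i +i* q`_i),
    (fun i => (- i.+1%:R)%:C); split.
    by move=> i /=; rewrite oppr_lt0 ltr0n.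
  by move=> t t0; rewrite -horner_exp_exp_poly /ga mem_set.
(* Neither [dens f] nor [dens ga] has masses, so the norm of the difference is its L1 norm. *)
rewrite /normA esum1 ?adde0; last first.
  move=> x _; rewrite (_ : (dens f - dens ga).2 x = 0) ?normc0//.
  exact: subr0.
rewrite (_ : (dens f - dens ga).1 = (fun t => f t - ga t))//.
have hR t : complex.Re (f t - ga t) = fr t - complex.Re (ga t).
  by rewrite fri; case: (ga t).
have hI t : complex.Im (f t - ga t) = fi t - complex.Im (ga t).
  by rewrite fri; case: (ga t).
apply: le_trans (normL1_le_ReIm _ _) _.
- by rewrite (funext hR); exact: measurable_funB.
- by rewrite (funext hI); exact: measurable_funB.
(* On the domain of integration the cut-off in [ga] is inactive, which leaves exactly the integrals
   of [hp] and [hq]. *)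
rewrite [eps]splitr EFinD; apply: leeD.
  by under eq_integral => t t0 do rewrite hR gaR patchE t0.
by under eq_integral => t t0 do rewrite hI gaI patchE t0.
Qed.
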